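(* For every $0<p<\infty$, $H^p(\Omega_+)\subset E^p(\Omega_+)$.
   Context: Let $a\colon\mathbb{R}\to\mathbb{R}$ satisfy $|a(u_1)-a(u_2)|\le M|u_1-u_2|$ for all $u_1,u_2\in\mathbb{R}$, with $M>0$ fixed. Put $\Gamma=\{u+\mathrm{i}a(u):u\in\mathbb{R}\}$, $\Omega_+=\{u+\mathrm{i}v: v>a(u)\}$, and let $|\mathrm{d}\zeta|=(1+a'(u)^2)^{1/2}\,\mathrm{d}u$ be arc length on $\Gamma$. For $0<p<\infty$, $H^p(\Omega_+)$ is the set of analytic functions $F$ on $\Omega_+$ with $\sup_{\tau>0}\left(\int_\Gamma|F(\zeta+\mathrm{i}\tau)|^p\,|\mathrm{d}\zeta|\right)^{1/p}<\infty$. For a simply connected domain $D\subset\mathbb{C}$ with at least two boundary points, $E^p(D)$ is the set of analytic functions $f$ on $D$ for which there is a sequence of rectifiable Jordan curves $C_1,C_2,\ldots$ in $D$ which eventually surround each compact subdomain of $D$ and satisfy $\sup_{n\ge1}\int_{C_n}|f(z)|^p\,|\mathrm{d}z|<\infty$. *)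

(* Defs.v *)
From HB Require Import structures.
From mathcomp Require Import all_boot all_order all_algebra.
From mathcomp Require Import all_classical all_reals all_analysis.
From mathcomp Require Import complex.
Set Implicit Arguments.
Unset Strict Implicit.
Unset Printing Implicit Defensive.
Import Order.TTheory GRing.Theory Num.Theory.
Import numFieldNormedType.Exports.
Local Open Scope classical_set_scope.
Local Open Scope ring_scope.

(* The complex numbers R[i] with the topology and the norm that the library
   gives to every numFieldType; analysis on C goes through this type. *)
Definition cplx (R : realType) : numClosedFieldType := R[i].

Section HardySpaces.
Variable R : realType.
Local Notation C := (cplx R).
Implicit Types (a : R -> R) (p : R) (D K U : set C) (f F : C -> C).
Implicit Types (c : R -> C) (g : C -> \bar R).

(* The modulus with values in R; the library norm `|z| lies in C. *)
Definition cmod (z : C) : R := complex.Re `|z|.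

Definition cmod_pow p (z : C) : \bar R := (cmod z `^ p)%:E.

(* Complex differentiability at each point of D, which is always open here.
   It depends only on the values of f on D: functions on D are represented by
   total functions whose values outside D play no role. *)
Definition analytic_on D f := forall z, D z -> derivable f z 1.

Definition domain U := [/\ U !=set0, open U & connected U].

Definition Omega_plus a : set C := [set z | a (complex.Re z) < complex.Im z].

(* The derivative of a Lipschitz function exists almost everywhere; the value
   of derive1 a elsewhere does not affect the integral. *)
Definition graph_integral a g : \bar R :=
  (\int[lebesgue_measure]_u
     (g (Complex u (a u)) * (Num.sqrt (1 + derive1 a u ^+ 2))%:E))%E.

Definition Hp a p : set (C -> C) :=
  [set F | analytic_on (Omega_plus a) F /\
    (ereal_sup
      [set (graph_integral a
              (fun z => cmod_pow p (F (z + Complex 0 tau)%R))) `^ p^-1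
      | tau in [set tau : R | (0 < tau)%R]] < +oo)%E].

(* Supremum of the lengths of the polygons inscribed in c over [s, t]. *)
Definition curve_length c (s t : R) : \bar R :=
  ereal_sup
    [set (\sum_(0 <= k < size l)
            cmod (c (nth t (s :: l) k.+1) - c (nth t (s :: l) k)))%:E
    | l in itv_partition s t].

Definition trace c : set C := c @` `[0, 1].

Definition rectifiable_jordan_curve c :=
  [/\ {within `[0, 1], continuous c},
      c 0 = c 1,
      {in `[0, 1[ &, injective c} &
      (curve_length c 0 1 < +oo)%E].

(* For c continuous and rectifiable, x |-> arc_length_param c x on
   [0, length of c] is the reparametrization of c by arc length. *)
Definition arc_length_param c (x : R) : C :=
  c (sup [set t : R | 0 <= t <= 1 /\ (curve_length c 0 t <= x%:E)%E]).

(* The integral of g with respect to arc length |dz| along c. *)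
Definition curve_integral c g : \bar R :=
  (\int[lebesgue_measure]_(x in `[0%R, fine (curve_length c 0 1)])
     g (arc_length_param c x))%E.

(* The interior of a Jordan curve: the union of the bounded components of the
   complement of its trace. *)
Definition inside c : set C :=
  [set z | ~ trace c z /\ bounded_set (connected_component (~` trace c) z)].

(* A compact subdomain of D is the closure of a domain, compact and contained
   in D. *)
Definition compact_subdomain D K :=
  exists U, [/\ domain U, K = closure U, compact K & K `<=` D].

(* Intended for D a simply connected domain with at least two boundary
   points. *)
Definition Ep p D : set (C -> C) :=
  [set f | analytic_on D f /\
    exists gamma : nat -> R -> C,
      [/\ forall n, rectifiable_jordan_curve (gamma n) /\ trace (gamma n) `<=` D,
          forall K, compact_subdomain D K ->
            \forall n \near \oo, K `<=` inside (gamma n) &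
          (ereal_sup (range (fun n =>
             curve_integral (gamma n) (fun z => cmod_pow p (f z)))) < +oo)%E]].

End HardySpaces.

(* Main.v *)
From HB Require Import structures.
Require Import Defs.
From mathcomp Require Import all_boot all_order all_algebra.
From mathcomp Require Import all_classical all_reals all_analysis.
From mathcomp Require Import measurable_realfun.
From mathcomp Require Import complex lra ring.
Import Order.TTheory GRing.Theory Num.Theory.
Import numFieldNormedType.Exports.
Local Open Scope classical_set_scope.
Local Open Scope ring_scope.
Set Implicit Arguments.
Unset Strict Implicit.
Unset Printing Implicit Defensive.

(* In the coordinates (u, v) |-> u + i (a u + v), the exhausting curves are the
   boundaries of the rectangles |u| <= U, 1/T <= v <= T with T = n + 2.  On the
   horizontal sides the integral of |F|^p is at most the H^p bound B.  By
   Tonelli the integral of |F|^p over T <= |u| <= 2 T, 1/T <= v <= T is at most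
   2 B T, so some U in [T, 2 T] has vertical sides on which the integral is
   bounded independently of T.  Arc length is compared with du and dv through a
   measure inequality: the arc length parameter is an expanding function of
   curve time. *)

(** The [Hp] hypothesis controls integrals along vertical translates of the graph and nothing else,
    so it gives no estimate on a prescribed vertical segment; averaging over the abscissa finds a
    good one. The averaging window has length [T] because the strip has height at most [T]: dividing
    the double integral by the window length cancels the growth of the strip. Membership in [Ep]
    asks only for finite upper bounds, so one-sided estimates suffice: the weight in
    [graph_integral] is bounded below by 1, and the length of a curve is bounded above by elapsed
    time, and neither is computed. The final constant depends on [M] and [B] alone. *)

(** * Integrals and expanding maps *)

(* [s @^-1` A `&` D] is contained in an interval of length [k * |A|]. *)
Lemma lebesgue_measure_expanding_itv (R : realType) (k x y : R) (D : set R)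
    (s : R -> R) : 0 < k -> measurable D -> measurable_fun setT s ->
  (forall u v, D u -> D v -> `|u - v| <= k * `|s u - s v|) ->
  (lebesgue_measure (s @^-1` `]x, y[ `&` D)
    <= k%:E * (wlength idfun `]x, y[%classic))%E.
Proof.
move=> k0 mD ms sD; set S := _ `&` D.
have [->|/set0P[u0 Su0]] := eqVneq S set0.
  by rewrite measure0 mule_ge0// ?lee_fin ?ltW// wlength_ge0.
have xy : x < y by case: Su0 => /=; rewrite in_itv/= => /andP[a b] _; exact: lt_trans b.
have bS u v : S u -> S v -> u - v <= k * (y - x).
  move=> [/=]; rewrite in_itv/= => /andP[xu uy] Du [/=].
  rewrite in_itv/= => /andP[xv vy] Dv.
  apply: (le_trans (ler_norm _)); apply: (le_trans (sD _ _ Du Dv)).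
  rewrite ler_pM2l// ler_norml; lra.
have uS : has_ubound S by exists (u0 + k * (y - x)) => u Su; have := bS u u0 Su Su0; lra.
have lS : has_lbound S by exists (u0 - k * (y - x)) => u Su; have := bS u0 u Su0 Su; lra.
have SI : S `<=` `[inf S, sup S].
  move=> u Su /=; rewrite in_itv/=; apply/andP; split.
    exact: ge_inf.
  exact: ub_le_sup.
have mS : measurable S by apply: measurableI => //; rewrite -[X in measurable X]setTI; exact: ms.
rewrite (@le_trans _ _ (lebesgue_measure `[inf S, sup S]%classic))//.
  by apply: le_measure; rewrite ?inE.
rewrite lebesgue_measure_itv /= wlength_itv /= !lte_fin xy.
case: ifPn => _; last first.
  by rewrite -EFinD -EFinM lee_fin mulr_ge0 ?subr_ge0// ltW.
rewrite -!EFinD -EFinM lee_fin lerBlDr; apply: ge_sup; first by exists u0.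
move=> u Su; rewrite -lerBlDl; apply: lb_le_inf; first by exists u0.
by move=> v Sv; have := bS u v Su Sv; lra.
Qed.

(** The measure of [A] is the infimum of the total lengths of its countable covers by open
    intervals. The preimages of a cover of [A] cover the preimage of [A], and the interval case
    bounds each of them. *)
Lemma lebesgue_measure_expanding (R : realType) (k : R) (D : set R)
    (s : R -> R) (A : set (measurableTypeR R)) :
  0 < k -> measurable D -> measurable_fun setT s ->
  (forall u v, D u -> D v -> `|u - v| <= k * `|s u - s v|) ->
  measurable A ->
  (lebesgue_measure (s @^-1` A `&` D) <= k%:E * lebesgue_measure A)%E.
Proof.
move=> k0 mD ms sD mA.
rewrite -lee_pdivrMl// [X in (_ <= X)%E]outer_measure_open_itv_cover.
apply: le_ereal_inf_tmp => _ [F [Fitv AF] <-].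
rewrite lee_pdivrMl// -nneseriesZl; last first.
  by move=> i _; rewrite wlength_ge0.
have mF i : measurable (F i) by have [[a b] ->] := Fitv i; exact: measurable_itv.
have msF i : measurable (s @^-1` F i `&` D).
  by apply: measurableI => //; rewrite -[X in measurable X]setTI; exact: ms.
have mBig : measurable (\bigcup_i (s @^-1` F i `&` D)) by exact: bigcupT_measurable.
apply: (@le_trans _ _ (lebesgue_measure (\bigcup_i (s @^-1` F i `&` D)))).
  apply: le_measure; rewrite ?inE//.
    by apply: measurableI => //; rewrite -[X in measurable X]setTI; exact: ms.
  by move=> u [/= /AF[i _ Fi] Du]; exists i.
apply: (le_trans (outer_measure_sigma_subadditive lebesgue_measure _)).
apply: lee_nneseries => // i _.
by have [[a b] ->] := Fitv i; exact: lebesgue_measure_expanding_itv.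
Qed.

(** The hypothesis says that the pushforward under [s] of [m1] restricted to [D] is dominated by [k]
    times [m2], and the integral of a nonnegative function is monotone in the measure. *)
Lemma ge0_integral_comp_le d1 d2 (X : measurableType d1) (Y : measurableType d2)
    (R : realType) (m1 : {measure set X -> \bar R})
    (m2 : {measure set Y -> \bar R}) (k : {nonneg R}) (D : set X) (s : X -> Y)
    (h : Y -> \bar R) :
  measurable D -> measurable_fun setT s ->
  (forall A, measurable A -> (m1 (s @^-1` A `&` D) <= k%:num%:E * m2 A)%E) ->
  (forall y, 0 <= h y)%E -> measurable_fun setT h ->
  (\int[m1]_(x in D) h (s x) <= k%:num%:E * \int[m2]_y h y)%E.
Proof.
move=> mD ms sD h0 mh; pose m1D := mrestr m1 mD.
have mhs : measurable_fun setT (h \o s) by exact: measurableT_comp.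
rewrite (@eq_measure_integral _ _ _ _ m1D); last first.
  by move=> A mA AD; rewrite /m1D/= /mrestr setIidl.
apply: (@le_trans _ _ (\int[m1D]_x (h \o s) x)%E).
  exact: ge0_subset_integral.
have -> : (\int[m1D]_x (h \o s) x = \int[pushforward m1D s]_y h y)%E.
  by rewrite ge0_integral_pushforward.
rewrite -ge0_integral_mscale//.
pose sm : {mfun X >-> Y} := HB.pack s (isMeasurableFun.Build _ _ X Y s ms).
exact: (@ge0_le_measure_integral _ _ _ (pushforward m1D sm) (mscale k m2)).
Qed.

Lemma integral_comp_expanding (R : realType) (k : R) (D : set R)
    (s : R -> R) (h : R -> \bar R) :
  0 < k -> measurable D -> measurable_fun setT s ->
  (forall u v, D u -> D v -> `|u - v| <= k * `|s u - s v|) ->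
  (forall x, 0 <= h x)%E -> measurable_fun setT h ->
  (\int[lebesgue_measure]_(x in D) h (s x)
    <= k%:E * \int[lebesgue_measure]_x h x)%E.
Proof.
move=> k0 mD ms sD h0 mh.
apply: (@ge0_integral_comp_le _ _ (measurableTypeR R) (measurableTypeR R) R
  lebesgue_measure lebesgue_measure (NngNum (ltW k0)) D s h) => // A mA.
exact: lebesgue_measure_expanding.
Qed.

(** * Length of Lipschitz curves *)

Section PolygonLength.
Variable R : realType.
Local Notation C := (cplx R).
Implicit Types (c : R -> C) (z w : C).

Lemma cmodE z : cmod z = Num.sqrt (complex.Re z ^+ 2 + complex.Im z ^+ 2).
Proof. by rewrite /cmod normc_def. Qed.

Lemma normrC_cmod z : `|z| = Complex (cmod z) 0 :> C.
Proof. by rewrite /cmod normc_def. Qed.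

Lemma cmod_ge0 z : 0 <= cmod z.
Proof. by rewrite cmodE sqrtr_ge0. Qed.

Lemma cmodD z w : cmod (z + w) <= cmod z + cmod w.
Proof.
have := ler_normD z w; rewrite !normrC_cmod lecE /= => /andP[_].
by [].
Qed.

Lemma cmod_le z : cmod z <= `|complex.Re z| + `|complex.Im z|.
Proof.
rewrite cmodE -[leRHS]ger0_norm ?addr_ge0// -[leRHS]sqrtr_sqr ler_wsqrtr//.
rewrite -[complex.Re z ^+ 2]real_normK ?num_real//.
rewrite -[complex.Im z ^+ 2]real_normK ?num_real//.
have := normr_ge0 (complex.Re z); have := normr_ge0 (complex.Im z); nra.
Qed.

Lemma Re_le_cmod z : `|complex.Re z| <= cmod z.
Proof. by rewrite cmodE -sqrtr_sqr ler_wsqrtr// lerDl sqr_ge0. Qed.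

Lemma Im_le_cmod z : `|complex.Im z| <= cmod z.
Proof. by rewrite cmodE -sqrtr_sqr ler_wsqrtr// lerDr sqr_ge0. Qed.

(** Recursive form of the sum in [curve_length], suited to induction on the partition. *)
Fixpoint polygon_length c (x : R) (l : seq R) : R :=
  if l is y :: l' then cmod (c y - c x) + polygon_length c y l' else 0.

Lemma polygon_lengthE c (d x : R) l :
  \sum_(0 <= k < size l) cmod (c (nth d (x :: l) k.+1) - c (nth d (x :: l) k))
  = polygon_length c x l.
Proof.
elim: l x => [|y l ih] x /=; first by rewrite big_geq.
by rewrite big_nat_recl//= -ih.
Qed.

Lemma curve_length_ge0 c (s t : R) : s <= t -> (0 <= curve_length c s t)%E.
Proof.
rewrite le_eqVlt => /predU1P[->|st].
  by apply: ereal_sup_ubound; exists [::] => /=; [split|rewrite big_geq].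
apply: le_ereal_sup_tmp; exists (cmod (c t - c s))%:E; last by rewrite lee_fin cmod_ge0.
by exists [:: t]; [exact: itv_partition1|rewrite (@polygon_lengthE c t)/= addr0].
Qed.

Lemma curve_lengthxx c (s : R) : curve_length c s s = 0%E.
Proof.
apply/eqP; rewrite eq_le curve_length_ge0// andbT.
apply: ge_ereal_sup => _ [l /itv_partitionxx -> <-]; by rewrite big_geq.
Qed.

Section Lipschitz.
Variables (c : R -> C) (K : R).
Hypothesis cK : forall x y, x <= y -> cmod (c y - c x) <= K * (y - x).

Lemma polygon_length_lipschitz x t l : itv_partition x t l ->
  polygon_length c x l <= K * (t - x).
Proof.
elim: l x => [|y l ih] x /= xt.
  by rewrite (itv_partition_nil xt) subrr mulr0.
have [/= /andP[xy _] _] := xt.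
have := ih _ (itv_partition_cons xt); have := cK (ltW xy).
rewrite !mulrBr; lra.
Qed.

(** The points of [l] before [t] are kept and closed off by [t]. The triangle inequality cuts the
    segment straddling [t], and the Lipschitz bound controls everything beyond [t]. *)
Lemma polygon_length_split x t t' l : itv_partition x t' l -> x <= t <= t' ->
  exists2 l1, itv_partition x t l1 &
    polygon_length c x l <= polygon_length c x l1 + K * (t' - t).
Proof.
elim: l x => [|y l ih] x /= xt /andP[xt1 tt'].
  move: xt1 tt'; rewrite -(itv_partition_nil xt) => xt1 tx.
  have -> : t = x by apply/eqP; rewrite eq_le xt1 tx.
  by exists [::]; rewrite //= subrr mulr0 addr0.
have [/= /andP[xy _] _] := xt.
have yt' := itv_partition_cons xt.
have [yt|ty] := leP y t.
  have [l1 yl1 le1] := ih _ yt' (introT andP (conj yt tt')).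
  exists (y :: l1); last by rewrite /= -addrA lerD2l.
  by have [p1 p2] := yl1; split => //=; rewrite xy.
have hl := polygon_length_lipschitz yt'; have hty := cK (ltW ty).
have hD := cmodD (c y - c t) (c t - c x).
move: hl hty hD; rewrite addrA subrK !mulrBr => hl hty hD.
move: xt1; rewrite le_eqVlt => /predU1P[xE|xlt].
  exists [::]; first by rewrite xE.
  by rewrite /= xE; lra.
exists [:: t]; first exact: itv_partition1.
by rewrite /=; lra.
Qed.

Lemma curve_length_lipschitz s t t' : s <= t <= t' ->
  (curve_length c s t' <= curve_length c s t + (K * (t' - t))%:E)%E.
Proof.
move=> stt'; apply: ge_ereal_sup => _ [l pl <-]; rewrite polygon_lengthE.
have [l1 pl1 le1] := polygon_length_split pl stt'.
apply: (@le_trans _ _ ((polygon_length c s l1)%:E + (K * (t' - t))%:E)%E).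
  by rewrite -EFinD lee_fin.
apply: leeD => //; apply: ereal_sup_ubound; exists l1 => //.
by rewrite polygon_lengthE.
Qed.

Lemma curve_length_lty (s t : R) : s <= t -> (curve_length c s t < +oo)%E.
Proof.
move=> st; have := @curve_length_lipschitz s s t; rewrite lexx st => /(_ isT).
by rewrite curve_lengthxx add0e => /le_lt_trans -> //; rewrite ltry.
Qed.

End Lipschitz.

End PolygonLength.

Section ArcLength.
Variables (R : realType) (c : R -> cplx R) (K : R).
Hypothesis K0 : 0 < K.
Hypothesis cK : forall x y, x <= y -> cmod (c y - c x) <= K * (y - x).

(** [arc_length_param c x] unfolds to [c] at this time; naming the time allows parameters to be
    compared instead of points. *)
Definition arc_length_time (x : R) : R :=
  sup [set t : R | 0 <= t <= 1 /\ (curve_length c 0 t <= x%:E)%E].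

Lemma has_sup_arc_length_time x : 0 <= x ->
  has_sup [set t : R | 0 <= t <= 1 /\ (curve_length c 0 t <= x%:E)%E].
Proof.
move=> x0; split; last by exists 1 => t [/andP[]].
by exists 0; rewrite /= lexx ler01 curve_lengthxx lee_fin.
Qed.

Lemma arc_length_time_ge0 x : 0 <= x -> 0 <= arc_length_time x.
Proof.
move=> x0; apply: ub_le_sup; first by case: (has_sup_arc_length_time x0).
by rewrite /= lexx ler01 curve_lengthxx lee_fin.
Qed.

Lemma arc_length_time_le1 x : 0 <= x -> arc_length_time x <= 1.
Proof.
move=> x0; apply: ge_sup; first by case: (has_sup_arc_length_time x0).
by move=> t [/andP[]].
Qed.

(** Over a further time [(y - x) / K] the length grows by at most [y - x]. Hence from any time with
    length at most [x] one can advance that far and still have length at most [y]. *)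
Lemma arc_length_time_expanding x y :
  0 <= x -> x <= y -> y <= fine (curve_length c 0 1) ->
  y - x <= K * (arc_length_time y - arc_length_time x).
Proof.
move=> x0 xy yL; have y0 := le_trans x0 xy.
have L_fin : curve_length c 0 1 \is a fin_num.
  by rewrite ge0_fin_numE ?curve_length_ge0// (curve_length_lty cK).
rewrite mulrC -ler_pdivrMr// lerBrDl -lerBrDr.
apply: ge_sup; first by case: (has_sup_arc_length_time x0).
move=> t [/andP[t0 t1] tx]; rewrite lerBrDr.
have K10 : 0 <= (y - x) / K by rewrite divr_ge0 ?subr_ge0// ltW.
have [td1|td1] := leP (t + (y - x) / K) 1.
  apply: ub_le_sup; first by case: (has_sup_arc_length_time y0).
  split; first by rewrite td1 addr_ge0.
  apply: (le_trans (curve_length_lipschitz cK (t := t) _)).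
    by rewrite t0 lerDl.
  rewrite addrAC subrr add0r mulrCA divff ?gt_eqF// mulr1.
  have -> : (y%:E = x%:E + (y - x)%:E)%E by rewrite -EFinD subrKC.
  exact: leeD.
(* Here the advance would pass the end of the curve, so the total length would be less than [y],
   against [yL]. *)
have : (curve_length c 0 1 < y%:E)%E.
  apply: (le_lt_trans (curve_length_lipschitz cK (t := t) _)).
    by rewrite t0.
  apply: (le_lt_trans (leeD tx (lexx _))).
  rewrite -EFinD lte_fin -ltrBrDl mulrC -ltr_pdivlMr//; lra.
by rewrite -(fineK L_fin) lte_fin ltNge yL.
Qed.

End ArcLength.

(** The loop over [[0, 1]] has Lipschitz constant [K * P], but its time is stretched by [P] to
    return to [[0, P]], and the factors [P] cancel: the stretched arc length time is expanding with
    constant [K]. *)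
Lemma curve_integral_le (R : realType) (c : R -> cplx R) (K P : R)
    (g : cplx R -> \bar R) : 0 < K -> 0 < P ->
  (forall x y, x <= y -> cmod (c y - c x) <= K * (y - x)) ->
  (forall z, 0 <= g z)%E -> measurable_fun `[0, P] (g \o c) ->
  (curve_integral (fun t => c (P * t)%R) g
    <= K%:E * \int[lebesgue_measure]_(x in `[0%R, P]) g (c x))%E.
Proof.
move=> K0 P0 cK g0 mg; set cP := fun t => c (P * t).
have cPK x y : x <= y -> cmod (cP y - cP x) <= (K * P) * (y - x).
  by move=> xy; rewrite -mulrA mulrBr cK// ler_pM2l.
have KP0 : 0 < K * P by exact: mulr_gt0.
have L0 : 0 <= fine (curve_length cP 0 1) by rewrite fine_ge0// curve_length_ge0.
rewrite /curve_integral; set L := fine _ in L0 *.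
(* Clamping to [[0, L]] extends the stretched time to the whole line, where the expanding inequality
   makes it nondecreasing, hence measurable. *)
pose s x := P * arc_length_time cP (Num.max 0 (Num.min x L)).
have clampE x : x \in `[0, L] -> Num.max 0 (Num.min x L) = x.
  by rewrite in_itv/= => /andP[x0 xL]; rewrite min_l// max_r.
have s_exp x y : 0 <= x -> x <= y -> y <= L ->
    y - x <= K * (P * arc_length_time cP y - P * arc_length_time cP x).
  move=> x0 xy yL; rewrite -mulrBr mulrA.
  exact: (arc_length_time_expanding KP0 cPK).
have ms : measurable_fun setT s.
  apply: nondecreasing_measurable => // x y xy.
  set x' := Num.max 0 (Num.min x L); set y' := Num.max 0 (Num.min y L).
  have x'0 : 0 <= x' by rewrite le_max lexx.
  have y'L : y' <= L by rewrite ge_max L0/= ge_min lexx orbT.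
  have xy' : x' <= y' by apply: le_max2 => //; exact: le_min2.
  have := s_exp _ _ x'0 xy' y'L; rewrite /s -/x' -/y' => h.
  rewrite -subr_ge0 -(pmulr_rge0 _ K0); apply: le_trans h; lra.
pose h := (g \o c) \_ `[0, P].
have -> : (\int[lebesgue_measure]_(x in `[0%R, L]) g (arc_length_param cP x) =
          \int[lebesgue_measure]_(x in `[0%R, L]) h (s x))%E.
  apply: eq_integral => x /[!inE]/= xL.
  have x0 : 0 <= x by move: xL; rewrite in_itv/= => /andP[].
  rewrite /h patchE mem_set//= /s clampE// in_itv/=.
  apply/andP; split.
    by apply: mulr_ge0; [exact: ltW|exact: arc_length_time_ge0].
  by apply: ler_piMr; [exact: ltW|exact: arc_length_time_le1].
rewrite [X in (_ <= _ * X)%E]integral_mkcond -/h.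
apply: integral_comp_expanding => //.
- move=> x y /= xL yL; rewrite /s !clampE//.
  move: xL yL; rewrite !in_itv/= => /andP[x0 xL] /andP[y0 yL].
  wlog xy : x y x0 xL y0 yL / x <= y.
    move=> H; have [|/ltW] := leP x y; first exact: H.
    by move=> yx; rewrite distrC [X in _ <= _ * X]distrC; exact: H.
  rewrite distrC ger0_norm ?subr_ge0// distrC.
  apply: (le_trans (s_exp _ _ x0 xy yL)).
  by rewrite ler_pM2l// ler_norm.
- by move=> x; apply: erestrict_ge0 => y _ /=.
- exact/(measurable_restrictT _ _).1.
Qed.

(** * Topology of the complex plane *)

Section ComplexTopology.
Variable R : realType.
Local Notation C := (cplx R).

Lemma gt0_cplx (e : C) : 0 < e -> e = Complex (complex.Re e) 0 /\ 0 < complex.Re e.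
Proof. by case: e => x y; rewrite ltcE/= => /andP[/eqP <- ?]. Qed.

Lemma ltC_cmod (z : C) (e : R) : (`|z| < Complex e 0) = (cmod z < e).
Proof. by rewrite normrC_cmod ltcE/= eqxx. Qed.

Lemma continuous_Complex (T : topologicalType) (f g : T -> R) :
  continuous f -> continuous g ->
  continuous (fun t => Complex (f t) (g t) : C).
Proof.
move=> cf cg t; apply/cvgrPdist_lt => e /gt0_cplx[-> e0].
have e20 : 0 < complex.Re e / 2 by exact: divr_gt0.
have /cvgrPdist_lt/(_ _ e20) hf := cf t.
have /cvgrPdist_lt/(_ _ e20) hg := cg t.
near=> s; rewrite ltC_cmod (le_lt_trans (cmod_le _))//=.
have : `|f t - f s| < complex.Re e / 2 by near: s.
have : `|g t - g s| < complex.Re e / 2 by near: s.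
lra.
Unshelve. all: by end_near. Qed.

Lemma continuous_cmod_lipschitz (f : C -> R) :
  (forall z w, `|f z - f w| <= cmod (z - w)) -> continuous f.
Proof.
move=> fL z; apply/(@cvgrPdist_lt _ _ _ (nbhs z)) => e e0.
have e0C : 0 < (Complex e 0 : C) by rewrite ltcE/= eqxx e0.
near=> w; rewrite (le_lt_trans (fL z w))// -ltC_cmod.
near: w; exact: cvgr_dist_lt.
Unshelve. all: by end_near. Qed.

Lemma continuous_Re : continuous (@complex.Re R : C -> R).
Proof.
by apply: continuous_cmod_lipschitz => z w; apply: le_trans (Re_le_cmod _); case: z w => ? ? [].
Qed.

Lemma continuous_Im : continuous (@complex.Im R : C -> R).
Proof.
by apply: continuous_cmod_lipschitz => z w; apply: le_trans (Im_le_cmod _); case: z w => ? ? [].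
Qed.

Lemma continuous_cmod : continuous (@cmod R).
Proof.
apply: continuous_cmod_lipschitz => z w.
have := cmodD (z - w) w; have := cmodD (w - z) z; rewrite !subrK.
have -> : cmod (w - z) = cmod (z - w) by rewrite /cmod distrC.
by rewrite ler_norml => h1 h2; apply/andP; split; lra.
Qed.

Lemma analytic_on_continuous (D : set C) (F : C -> C) :
  analytic_on D F -> forall z, D z -> {for z, continuous F}.
Proof.
by move=> aF z /aF /derivable1_diffP /differentiable_continuous.
Qed.

(** By the intermediate value theorem, a change of sign on [A] would produce a zero of [N]. *)
Lemma connected_continuous_lt0 (T : topologicalType) (A : set T) (N : T -> R)
    (z : T) : continuous N -> connected A -> (forall w, A w -> N w != 0) ->
  A z -> N z < 0 -> forall w, A w -> N w < 0.
Proof.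
move=> cN cA N0 Az Nz w Aw; rewrite ltNge; apply/negP => Nw.
have : connected (N @` A).
  by apply: connected_continuous_connected => //; exact: continuous_subspaceT.
move=> /connected_intervalP/(_ (N z) (N w) (imageP _ Az) (imageP _ Aw) 0).
rewrite (ltW Nz) Nw => /(_ isT)[v Av]; apply/eqP; exact: N0.
Qed.

End ComplexTopology.

(** * Curvilinear rectangles *)

Section Box.
Variables (R : realType) (a : R -> R) (M : R).
Hypothesis M0 : 0 < M.
Hypothesis aM : forall u1 u2 : R, `|a u1 - a u2| <= M * `|u1 - u2|.
Local Notation C := (cplx R).

Definition graph_point (u v : R) : C := Complex u (a u + v).

(** Building the boundary curve from truncations makes it continuous and Lipschitz on the whole
    line, with no gluing at the corners. *)
Definition clamp (W x : R) : R := Num.max 0 (Num.min x W).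

Lemma clamp_le0 W x : x <= 0 -> clamp W x = 0.
Proof. by move=> x0; rewrite /clamp max_l// ge_min x0. Qed.

Lemma clamp_id W x : 0 <= x <= W -> clamp W x = x.
Proof. by move=> /andP[x0 xW]; rewrite /clamp min_l// max_r. Qed.

Lemma clamp_ge W x : 0 <= W -> W <= x -> clamp W x = W.
Proof. by move=> W0 Wx; rewrite /clamp min_r// max_r. Qed.

Lemma clamp_lipschitz W x y : 0 <= W -> x <= y -> 0 <= clamp W y - clamp W x <= y - x.
Proof.
move=> W0 xy.
have [x0|x0] := leP x 0; have [y0|y0] := leP y 0; have [xW|xW] := leP x W;
  have [yW|yW] := leP y W; do 2?[rewrite clamp_le0; last lra|
  rewrite clamp_ge; [|lra..]|rewrite clamp_id; last lra]; lra.
Qed.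

Lemma continuous_clamp W : continuous (clamp W).
Proof.
move=> x; apply: (@continuous_max _ _ (fun=> 0) (fun y => Num.min y W)); first exact: cst_continuous.
by apply: (@continuous_min _ _ id (fun=> W)); [exact: cvg_id|exact: cst_continuous].
Qed.

Lemma continuous_lipschitz_graph : continuous a.
Proof.
move=> x; apply/(@cvgrPdist_lt _ _ _ (nbhs x)) => e e0.
have e1 : 0 < e / M by rewrite divr_gt0.
near=> y; rewrite (le_lt_trans (aM _ _))// mulrC -ltr_pdivlMr//.
Unshelve. all: by end_near. Qed.

Lemma continuous_graph_point (T : topologicalType) (f g : T -> R) :
  continuous f -> continuous g -> continuous (fun t => graph_point (f t) (g t)).
Proof.
move=> cf cg; apply: continuous_Complex => // t.
by apply: continuousD; [apply: continuous_comp; [exact: cf|exact: continuous_lipschitz_graph]|exact: cg].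
Qed.

Variables (U tau H : R).
Hypotheses (U0 : 0 < U) (H0 : 0 < H).

(** The first truncation carries the abscissa from [- U] to [U] along the bottom, the second brings
    it back along the top; both are constant on the vertical sides. [box_height] does the same with
    the roles of the sides exchanged. *)
Definition box_abs (x : R) : R :=
  clamp (2 * U) x - clamp (2 * U) (x - (2 * U + H)) - U.

Definition box_height (x : R) : R :=
  tau + clamp H (x - 2 * U) - clamp H (x - (4 * U + H)).

(* Runs counterclockwise from the lower left corner, each side being
   parametrized with unit speed in the coordinates (u, v). *)
Definition box_curve (x : R) : C := graph_point (box_abs x) (box_height x).

Definition box_perimeter : R := 4 * U + 2 * H.

Lemma box_perimeter_gt0 : 0 < box_perimeter.
Proof. by move: (U0) (H0) => U_gt0 H_gt0; rewrite /box_perimeter; lra. Qed.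

Lemma box_curve_bottom x : 0 <= x <= 2 * U ->
  box_abs x = x - U /\ box_height x = tau.
Proof.
move: (U0) (H0) => U_gt0 H_gt0.
move=> /andP[x0 x1]; rewrite /box_abs /box_height clamp_id ?x0//.
by rewrite !clamp_le0; [split; lra|lra..].
Qed.

Lemma box_curve_right x : 2 * U <= x <= 2 * U + H ->
  box_abs x = U /\ box_height x = tau + (x - 2 * U).
Proof.
move: (U0) (H0) => U_gt0 H_gt0.
move=> /andP[x0 x1]; rewrite /box_abs /box_height clamp_ge; [|lra..].
rewrite clamp_le0; last lra. rewrite clamp_id; last by apply/andP; split; lra.
by rewrite clamp_le0; [split; lra|lra].
Qed.

Lemma box_curve_top x : 2 * U + H <= x <= 4 * U + H ->
  box_abs x = 3 * U + H - x /\ box_height x = tau + H.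
Proof.
move: (U0) (H0) => U_gt0 H_gt0.
move=> /andP[x0 x1]; rewrite /box_abs /box_height clamp_ge; [|lra..].
rewrite clamp_id; last by apply/andP; split; lra.
rewrite clamp_ge; [|lra..].
by rewrite clamp_le0; [split; lra|lra].
Qed.

Lemma box_curve_left x : 4 * U + H <= x <= box_perimeter ->
  box_abs x = - U /\ box_height x = tau + (box_perimeter - x).
Proof.
move: (U0) (H0) => U_gt0 H_gt0.
rewrite /box_perimeter => /andP[x0 x1]; rewrite /box_abs /box_height.
do 3 (rewrite clamp_ge; [|lra..]).
by rewrite clamp_id; [split; lra|apply/andP; split; lra].
Qed.

Lemma box_curve_side x : 0 <= x <= box_perimeter ->
  [\/ 0 <= x <= 2 * U, 2 * U <= x <= 2 * U + H,
      2 * U + H <= x <= 4 * U + H | 4 * U + H <= x <= box_perimeter].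
Proof.
move=> /andP[x0 xP].
have [x1|/ltW x1] := leP x (2 * U); first by apply: Or41; apply/andP.
have [x2|/ltW x2] := leP x (2 * U + H); first by apply: Or42; apply/andP.
have [x3|/ltW x3] := leP x (4 * U + H); first by apply: Or43; apply/andP.
by apply: Or44; apply/andP.
Qed.

(** Each truncation moves by at most [y - x]. The crude factor 2 for each of the two coordinates,
    and [2 * M] for the variation of [a], add up to [4 + 2 * M]. *)
Lemma box_curve_lipschitz x y : x <= y ->
  cmod (box_curve y - box_curve x) <= (4 + 2 * M) * (y - x).
Proof.
move: (U0) (H0) (M0) => U_gt0 H_gt0 M_gt0.
move=> xy; rewrite (le_trans (cmod_le _))//=.
set u := box_abs _; set u' := box_abs _.
have uu : `|u - u'| <= 2 * (y - x).
  have /andP[h1 h2] := @clamp_lipschitz (2 * U) _ _ (ltW (mulr_gt0 (ltr0Sn R 1) U0)) xy.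
  have xy' : x - (2 * U + H) <= y - (2 * U + H) by lra.
  have /andP[h3 h4] := @clamp_lipschitz (2 * U) _ _ (ltW (mulr_gt0 (ltr0Sn R 1) U0)) xy'.
  by rewrite /u /u' /box_abs ler_norml; apply/andP; split; lra.
have vv : `|box_height y - box_height x| <= 2 * (y - x).
  have xy1 : x - 2 * U <= y - 2 * U by lra.
  have xy2 : x - (4 * U + H) <= y - (4 * U + H) by lra.
  have /andP[h1 h2] := @clamp_lipschitz H _ _ (ltW H0) xy1.
  have /andP[h3 h4] := @clamp_lipschitz H _ _ (ltW H0) xy2.
  by rewrite /box_height ler_norml; apply/andP; split; lra.
have aa := le_trans (aM u u') (ler_wpM2l (ltW M0) uu).
have := ler_normD (a u - a u') (box_height y - box_height x).
rewrite [X in `|X| <= _](_ : _ = a u + box_height y - (a u' + box_height x)); last lra.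
move: aa uu vv; nra.
Qed.

Lemma box_curve_closed : box_curve 0 = box_curve box_perimeter.
Proof.
move: (U0) (H0) => U_gt0 H_gt0.
have [|h1 h2] := @box_curve_bottom 0; first by apply/andP; split; lra.
have [|h3 h4] := @box_curve_left box_perimeter.
  by rewrite /box_perimeter; apply/andP; split; lra.
by rewrite /box_curve h1 h2 h3 h4; congr graph_point; lra.
Qed.

Lemma graph_point_inj u v u' v' : graph_point u v = graph_point u' v' ->
  u = u' /\ v = v'.
Proof. by move=> [<- /addrI]. Qed.

Lemma box_curve_inj : {in `[0, box_perimeter[ &, injective box_curve}.
Proof.
move: (U0) (H0) => U_gt0 H_gt0.
move=> x y; rewrite !in_itv/= => /andP[x0 xP] /andP[y0 yP] /graph_point_inj[].
have sx : 0 <= x <= box_perimeter by rewrite x0 ltW.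
have sy : 0 <= y <= box_perimeter by rewrite y0 ltW.
(* For each of the sixteen pairs of sides both coordinates are affine, so linear arithmetic decides;
   the half-open interval excludes the second passage through the starting corner. *)
case: (box_curve_side sx) => hx; [have [-> ->] := box_curve_bottom hx
  |have [-> ->] := box_curve_right hx|have [-> ->] := box_curve_top hx
  |have [-> ->] := box_curve_left hx];
(case: (box_curve_side sy) => hy; [have [-> ->] := box_curve_bottom hy
  |have [-> ->] := box_curve_right hy|have [-> ->] := box_curve_top hy
  |have [-> ->] := box_curve_left hy]) => e1 e2;
by move: hx hy xP yP e1 e2; rewrite /box_perimeter => /andP[? ?] /andP[? ?] *; lra.
Qed.

Definition graph_height (z : C) : R := complex.Im z - a (complex.Re z).

Lemma graph_point_height z : graph_point (complex.Re z) (graph_height z) = z.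
Proof. by case: z => x y; rewrite /graph_point /graph_height/= addrC subrK. Qed.

(* Negative inside the curvilinear rectangle, zero exactly on its boundary; this
   replaces the Jordan curve theorem. *)
Definition box_gauge (z : C) : R :=
  Num.max (`|complex.Re z| - U)
    (Num.max (tau - graph_height z) (graph_height z - (tau + H))).

Lemma continuous_graph_height : continuous graph_height.
Proof.
move=> z; apply: continuousB; first exact: continuous_Im.
by apply: continuous_comp; [exact: continuous_Re|exact: continuous_lipschitz_graph].
Qed.

Lemma continuous_box_gauge : continuous box_gauge.
Proof.
move=> z; apply: (@continuous_max R C (fun z => `|complex.Re z| - U)
  (fun z => Num.max (tau - graph_height z) (graph_height z - (tau + H)))).
  apply: (@continuousB _ _ _ (fun z : C => `|complex.Re z|)); last exact: cst_continuous.
  by apply: continuous_comp; [exact: continuous_Re|exact: norm_continuous].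
apply: (@continuous_max R C (fun z => tau - graph_height z)
  (fun z => graph_height z - (tau + H))); apply: continuousB;
  by [exact: cst_continuous|exact: continuous_graph_height].
Qed.

Definition box_loop (t : R) : C := box_curve (box_perimeter * t).

Lemma trace_box_loop z : trace box_loop z <->
  exists2 x, 0 <= x <= box_perimeter & z = box_curve x.
Proof.
have P0 := box_perimeter_gt0.
split=> [[t /=]|[x /andP[x0 xP] ->]].
  rewrite in_itv/= => /andP[t0 t1] <-; exists (box_perimeter * t) => //.
  by apply/andP; split; [apply: mulr_ge0|apply: ler_piMr] => //; exact: ltW.
exists (x / box_perimeter).
  by rewrite /= in_itv/= ler_pdivrMr// mul1r xP divr_ge0// ltW.
by rewrite /box_loop mulrC divfK// gt_eqF.
Qed.

Lemma trace_box_gauge z : trace box_loop z -> box_gauge z = 0.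
Proof.
move: (U0) (H0) => U_gt0 H_gt0.
move=> /trace_box_loop[x sx ->]; rewrite /box_gauge /graph_height/=.
rewrite [a _ + _]addrC addrK.
case: (box_curve_side sx) => hx; [have [-> ->] := box_curve_bottom hx
  |have [-> ->] := box_curve_right hx|have [-> ->] := box_curve_top hx
  |have [-> ->] := box_curve_left hx]; move: hx; rewrite /box_perimeter => /andP[h1 h2].
- rewrite max_r; last by rewrite le_max; apply/orP; left; rewrite lerBlDr subrr add0r ler_norml; apply/andP; split; lra.
  by rewrite max_l; lra.
- by rewrite gtr0_norm// subrr max_l// ge_max; apply/andP; split; lra.
- rewrite max_r; last by rewrite le_max; apply/orP; right; rewrite lerBlDr subrr add0r ler_norml; apply/andP; split; lra.
  by rewrite max_r; lra.
- by rewrite normrN gtr0_norm// subrr max_l// ge_max; apply/andP; split; lra.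
Qed.

Lemma box_gauge_trace z : box_gauge z = 0 -> trace box_loop z.
Proof.
move: (U0) (H0) => U_gt0 H_gt0.
move=> g0; have : box_gauge z <= 0 by rewrite g0.
have : ~~ (box_gauge z < 0) by rewrite g0 ltxx.
rewrite /box_gauge !gt_max !ge_max !negb_and -!leNgt.
move: (graph_point_height z).
set u := complex.Re z; set v := graph_height z.
move=> zE side /and3P[+ v1 v2]; rewrite subr_le0 ler_norml => /andP[u1 u2].
(* One of the three terms of the gauge is nonnegative and selects the side: right or left by the
   sign of [u], then bottom, then top. The upper bounds keep [z] within the range of that side. *)
apply/trace_box_loop; case/or3P: side => side.
- have [u0|/ltW u0] := leP 0 u.
    rewrite ger0_norm// in side.
    have hx : 2 * U <= 2 * U + (v - tau) <= 2 * U + H by apply/andP; split; lra.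
    exists (2 * U + (v - tau)); first by rewrite /box_perimeter; apply/andP; split; lra.
    by rewrite /box_curve; have [-> ->] := box_curve_right hx; rewrite -{1}zE; congr graph_point; lra.
  rewrite ler0_norm// in side.
  have hx : 4 * U + H <= box_perimeter - (v - tau) <= box_perimeter.
    by rewrite /box_perimeter; apply/andP; split; lra.
  exists (box_perimeter - (v - tau)); first by move: hx => /andP[? ?]; apply/andP; split; lra.
  by rewrite /box_curve; have [-> ->] := box_curve_left hx; rewrite -{1}zE; congr graph_point; lra.
- have hx : 0 <= u + U <= 2 * U by apply/andP; split; lra.
  exists (u + U); first by rewrite /box_perimeter; apply/andP; split; lra.
  by rewrite /box_curve; have [-> ->] := box_curve_bottom hx; rewrite -{1}zE; congr graph_point; lra.
- have hx : 2 * U + H <= 3 * U + H - u <= 4 * U + H by apply/andP; split; lra.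
  exists (3 * U + H - u); first by rewrite /box_perimeter; apply/andP; split; lra.
  by rewrite /box_curve; have [-> ->] := box_curve_top hx; rewrite -{1}zE; congr graph_point; lra.
Qed.

Lemma continuous_clamp_shift W b : continuous (fun x : R => clamp W (x - b)).
Proof.
move=> x; apply: (@continuous_comp R R R (fun x => x - b) (clamp W));
  last exact: continuous_clamp.
by apply: continuousB; [exact: cvg_id|exact: cst_continuous].
Qed.

Lemma continuous_box_abs : continuous box_abs.
Proof.
move=> x; apply: (@continuousB _ _ _
  (clamp (2 * U) \- (fun x => clamp (2 * U) (x - (2 * U + H)))));
  last exact: cst_continuous.
by apply: continuousB; [exact: continuous_clamp|exact: continuous_clamp_shift].
Qed.

Lemma continuous_box_height : continuous box_height.
Proof.
move=> x; apply: (@continuousB _ _ _ (fun x => tau + clamp H (x - 2 * U)));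
  last exact: continuous_clamp_shift.
by apply: continuousD; [exact: cst_continuous|exact: continuous_clamp_shift].
Qed.

Lemma continuous_box_curve : continuous box_curve.
Proof.
by apply: continuous_graph_point; [exact: continuous_box_abs|exact: continuous_box_height].
Qed.

Lemma rectifiable_jordan_box_loop : rectifiable_jordan_curve box_loop.
Proof.
have P0 := box_perimeter_gt0.
split.
- apply: continuous_subspaceT => t.
  apply: (@continuous_comp R R C (fun t => box_perimeter * t) box_curve);
    last exact: continuous_box_curve.
  exact: mulrl_continuous.
- by rewrite /box_loop mulr0 mulr1 box_curve_closed.
- move=> s t; rewrite !in_itv/= => /andP[s0 s1] /andP[t0 t1] st.
  have box_in r : 0 <= r -> r < 1 -> box_perimeter * r \in `[0, box_perimeter[.
    move=> r0 r1; rewrite in_itv/= mulr_ge0//=; last exact: ltW.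
    by rewrite -[ltRHS]mulr1 ltr_pM2l.
  by apply/(mulfI (lt0r_neq0 P0))/box_curve_inj; rewrite ?box_in.
- apply: (@curve_length_lty _ _ ((4 + 2 * M) * box_perimeter)) => // s t st.
  by rewrite -mulrA mulrBr box_curve_lipschitz// ler_pM2l.
Qed.

Lemma trace_box_loop_Omega_plus : 0 < tau -> trace box_loop `<=` Omega_plus a.
Proof.
move: (U0) (H0) => U_gt0 H_gt0.
move=> t0 z /trace_box_loop[x sx ->]; rewrite /Omega_plus/= ltrDl.
case: (box_curve_side sx) => hx; [have [_ ->] := box_curve_bottom hx
  |have [_ ->] := box_curve_right hx|have [_ ->] := box_curve_top hx
  |have [_ ->] := box_curve_left hx]; move: hx => /andP[h1 h2]; lra.
Qed.

Lemma bounded_box_gauge : bounded_set [set z | box_gauge z < 0].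
Proof.
move: (U0) (H0) (M0) => U_gt0 H_gt0 M_gt0.
(* [U] bounds the real part, [|a 0| + M * U] bounds [a] on [[- U, U]], and [|tau| + H] bounds the
   height above the graph. *)
pose B := U + (`|a 0| + M * U + `|tau| + H).
exists (Complex B 0); split.
  apply: ger0_real; rewrite lecE/= eqxx/= /B.
  by rewrite !addr_ge0// ?mulr_ge0// ltW.
move=> e Be z /=; rewrite /box_gauge !gt_max => /and3P[z1 z2 z3].
have : cmod z <= B; last first.
  move=> zB; apply: le_trans (ltW Be); rewrite normrC_cmod lecE/= eqxx//.
apply: (le_trans (cmod_le z)); apply: lerD; first by lra.
have -> : complex.Im z = graph_height z + (a (complex.Re z) - a 0) + a 0.
  by rewrite /graph_height; lra.
have h1 : `|a (complex.Re z) - a 0| <= M * U.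
  by apply: (le_trans (aM _ _)); rewrite subr0 ler_pM2l//; lra.
have h2 : `|graph_height z| <= `|tau| + H.
  have := ler_norm tau; have := ler_norm (- tau); rewrite normrN => *.
  by rewrite ler_norml; apply/andP; split; lra.
have := ler_normD (graph_height z + (a (complex.Re z) - a 0)) (a 0).
have := ler_normD (graph_height z) (a (complex.Re z) - a 0).
lra.
Qed.

(** The gauge vanishes only on the trace, so it stays negative on the component of [z] in the
    complement; that component lies in a bounded set. *)
Lemma box_gauge_inside z : box_gauge z < 0 -> inside box_loop z.
Proof.
move=> z0; have zt : ~ trace box_loop z.
  by move=> /trace_box_gauge gz; rewrite gz ltxx in z0.
split=> //; apply: sub_boundedr bounded_box_gauge => A hA w zw; apply: hA.
apply: (@connected_continuous_lt0 R C _ _ z continuous_box_gauge _ _ _ z0 w zw).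
- exact: component_connected.
- move=> v /connected_component_sub vt; apply/eqP => /box_gauge_trace.
  exact: vt.
- exact: connected_component_refl.
Qed.

End Box.

(** * Tonelli selection and the Hardy bound *)

Lemma nbhs_rat_itv (R : realType) (x : R) (A : set R) : nbhs x A ->
  exists q : rat * rat, (ratr q.1 < x < ratr q.2) /\ `]ratr q.1, ratr q.2[ `<=` A.
Proof.
move=> /nbhs_ballP[e /= e0 xA].
have [|q1] := @rat_in_itvoo R (x - e) x; first by lra.
have [|q2] := @rat_in_itvoo R x (x + e); first by lra.
rewrite !in_itv/= => /andP[xq2 q2e] /andP[eq1 q1x].
exists (q1, q2); split=> /=; first by rewrite q1x.
move=> y /=; rewrite in_itv/= => /andP[q1y yq2]; apply: xA.
by rewrite /ball/= ltr_distl; apply/andP; split; lra.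
Qed.

(** Measurability refers to the product sigma-algebra, so an open set of the plane has to be written
    as a countable union of measurable rectangles; those with rational vertices suffice. *)
Lemma measurable_fun_continuous2 (R : realType) (f : R -> R -> R) :
  continuous (fun z : R * R => f z.1 z.2) ->
  measurable_fun [set: measurableTypeR R * measurableTypeR R]
    (fun z => f z.1 z.2).
Proof.
move=> cf; apply: (measurability (@RGenOInfty.G R)) => [|/= _ [_] [r] -> <-].
  exact: RGenOInfty.measurableE.
rewrite setTI.
pose rect (q : (rat * rat) * (rat * rat)) : set (R * R) :=
  `]ratr q.1.1, ratr q.1.2[ `*` `]ratr q.2.1, ratr q.2.2[.
pose S : set (R * R) := [set z | r < f z.1 z.2].
rewrite (_ : _ @^-1` _ = S); last by apply/seteqP; split=> z /=; rewrite in_itv/= andbT.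
rewrite (_ : S = \bigcup_q (if `[< rect q `<=` S >] then rect q else set0)); last first.
  apply/seteqP; split=> [[u v] uvS|[u v] [q _]]; last first.
    by case: ifPn => // /asboolP; apply.
  have : nbhs ((u, v) : R * R) S.
    apply: (cf (u, v) [set y | r < y]); apply: open_nbhs_nbhs; split => //.
  move=> [[A B] /= [/nbhs_rat_itv[q1 [q1u q1A]] /nbhs_rat_itv[q2 [q2v q2B]]] AB].
  exists (q1, q2) => //; rewrite ifT; first by split => /=; rewrite in_itv.
  apply/asboolP => -[u' v'] [/= /q1A Au' /q2B Bv']; exact: AB.
apply: countable_bigcupT_measurable => // q; case: ifP => // _.
exact: measurableX.
Qed.

(* [g] need not be measurable: in [graph_integral] the weight involves
   [derive1 a], which is arbitrary where [a] is not differentiable. *)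
Lemma le_integral_of_nonneg d (T : measurableType d) (R : realType)
    (mu : {measure set T -> \bar R}) (f g : T -> \bar R) :
  (forall x, 0 <= f x)%E -> (forall x, f x <= g x)%E ->
  (\int[mu]_x f x <= \int[mu]_x g x)%E.
Proof.
move=> f0 fg; rewrite !ge0_integralTE//; last by move=> x; exact: le_trans (fg x).
by apply: ereal_sup_le => _ [h hf <-]; exists h => // x; exact: le_trans (fg x).
Qed.

(** If every slice over [[N, 2 * N]] exceeded [B + 1], the double integral would be at least
    [(B + 1) * N], whereas the other order of integration gives at most [B * N], as [t - s <= N].
    The added 1 makes the contradiction strict. *)
Lemma exists_slice_integral_le (R : realType) (f : R -> R -> R) (B N s t : R) :
  measurable_fun [set: measurableTypeR R * measurableTypeR R]
    (fun z => f z.1 z.2) ->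
  (forall u v, 0 <= f u v) ->
  0 < N -> t - s <= N -> 0 <= B ->
  (forall v, s <= v <= t ->
    (\int[lebesgue_measure]_u (f u v)%:E <= B%:E)%E) ->
  exists2 u, N <= u <= 2 * N &
    (\int[lebesgue_measure]_(v in `[s, t]) (f u v)%:E <= (B + 1)%:E)%E.
Proof.
move=> mf f0 N0 tsN B0 fB.
pose f' (z : R * R) : \bar R := (f z.1 z.2)%:E.
pose D : set (measurableTypeR R * measurableTypeR R) := `[N, 2 * N] `*` `[s, t].
have mD : measurable D by exact: measurableX.
have mf' : measurable_fun [set: measurableTypeR R * measurableTypeR R] f'.
  by exact/measurable_EFinP.
have mF : measurable_fun [set: measurableTypeR R * measurableTypeR R] (f' \_ D).
  by apply/(measurable_restrictT _ _).1 => //; exact: measurable_funTS.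
have F0 z : (0 <= (f' \_ D) z)%E by apply: erestrict_ge0 => ? _; rewrite lee_fin.
apply: contrapT => /forallPNP nB.
have slice u v : u \in `[N, 2 * N] ->
    (f' \_ D) (u, v) = ((fun v => (f u v)%:E) \_ `[s, t]) v.
  move=> uN; rewrite !patchE; congr (if _ then _ else _).
  by apply/idP/idP; rewrite !inE; [case|split].
have := @fubini_tonelli _ _ _ _ R lebesgue_measure lebesgue_measure _ mF F0.
apply/eqP; rewrite gt_eqF//.
have tsN' : (lebesgue_measure `[s, t] <= N%:E)%E.
  rewrite lebesgue_measure_itv/=; case: ifPn => _; last by rewrite lee_fin ltW.
  by rewrite -EFinD lee_fin.
apply: (@le_lt_trans _ _ (B%:E * lebesgue_measure `[s, t])%E).
  rewrite -integral_cst// integral_mkcond; apply: le_integral_of_nonneg => v.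
    exact: integral_ge0.
  rewrite patchE; case: ifPn => [|/negP] vst.
    rewrite inE/= in_itv/= in vst; apply: le_trans (fB _ vst).
    apply: le_integral_of_nonneg => // u; rewrite patchE.
    by case: ifPn => // _; rewrite lee_fin.
  rewrite integral0_eq// => u _; rewrite patchE ifF//.
  by apply/negP; rewrite inE => -[_ vD]; apply: vst; rewrite inE.
apply: (@lt_le_trans _ _ ((B + 1) * N)%:E).
  apply: (@le_lt_trans _ _ (B%:E * N%:E)%E); first by apply: lee_wpmul2l; rewrite ?lee_fin.
  by rewrite -EFinM lte_fin ltr_pM2r//; lra.
have -> : ((B + 1) * N)%:E = ((B + 1)%:E * lebesgue_measure `[N, (2 * N)%R])%E.
  rewrite lebesgue_measure_itv/= lte_fin ifT; last lra.
  by rewrite -EFinD -EFinM; congr (_%:E); ring.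
rewrite -integral_cst// integral_mkcond; apply: le_integral_of_nonneg => u.
  by apply: erestrict_ge0 => ? _; rewrite lee_fin; lra.
rewrite patchE; case: ifPn => [|_]; last exact: integral_ge0.
rewrite inE/= => uN; under eq_integral do rewrite slice//.
rewrite -integral_mkcond leNgt; apply/negP => /ltW.
by apply: nB; rewrite in_itv in uN.
Qed.

(** Arc length dominates [du], since the weight is at least 1 whatever the value of [derive1 a];
    raising to the power [p] undoes the exponent [p^-1]. *)
Lemma Hp_integral_bound (R : realType) (a : R -> R) (p : R) (F : cplx R -> cplx R) :
  0 < p -> Hp a p F ->
  exists2 B : R, 0 <= B & forall tau, 0 < tau ->
    (\int[lebesgue_measure]_u cmod_pow p (F (graph_point a u tau)) <= B%:E)%E.
Proof.
move=> p0 [_]; set S := ereal_sup _ => Soo.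
pose I tau := graph_integral a (fun z => cmod_pow p (F (z + Complex 0 tau)%R)).
have I0 tau : (0 <= I tau)%E.
  apply: integral_ge0 => u _; apply: mule_ge0; rewrite lee_fin ?powR_ge0//.
have IS tau : 0 < tau -> (I tau `^ p^-1 <= S)%E.
  by move=> t0; apply: ereal_sup_ubound; exists tau.
have S0 : (0 <= S)%E by apply: le_trans (IS 1 ltr01); exact: poweR_ge0.
have SE : S = (fine S)%:E by rewrite fineK// ge0_fin_numE.
exists (fine S `^ p); first exact: powR_ge0.
move=> tau t0; apply: (@le_trans _ _ (I tau)).
  apply: le_integral_of_nonneg => u; first by rewrite lee_fin powR_ge0.
  have -> : graph_point a u tau = Complex u (a u) + Complex 0 tau :> cplx R.
    by apply/eqP; rewrite eq_complex/= addr0 !eqxx.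
  apply: lee_pemulr; first by rewrite lee_fin powR_ge0.
  by rewrite lee_fin -[leLHS]sqrtr1 ler_wsqrtr// lerDl sqr_ge0.
rewrite -poweR_EFin -SE -[leLHS]poweRe1// -(mulVf (lt0r_neq0 p0)) poweRrM.
apply: gt0_ler_poweR; [exact: ltW|by rewrite in_itv/= poweR_ge0 leey| |exact: IS].
by rewrite in_itv/= S0 leey.
Qed.

(** * Integrals along the curvilinear rectangles *)

Lemma integral_itv_split_le (R : realType) (f : R -> \bar R) (x y z : R) :
  (forall t, 0 <= f t)%E -> measurable_fun setT f -> x <= y -> y <= z ->
  (\int[lebesgue_measure]_(t in `[x, z]) f t
    <= \int[lebesgue_measure]_(t in `[x, y]) f t
       + \int[lebesgue_measure]_(t in `[y, z]) f t)%E.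
Proof.
move=> f0 mf xy yz.
rewrite (@itv_bndbnd_setU _ _ (BLeft x) (BRight y) (BRight z)) ?bnd_simp//.
rewrite ge0_integral_setU//=; last 2 first.
- exact: measurable_funS mf.
- apply/disj_set2P/seteqP; split=> // t /= []; rewrite !in_itv/= => /andP[_ ty] /andP[yt _].
  by move: (lt_le_trans yt ty); rewrite ltxx.
apply: leeD => //; rewrite integral_itv_obnd_cbnd//.
exact: measurable_funS mf.
Qed.

(** The case [k = 1], used for the translations and reflections that parametrize the sides. *)
Lemma integral_comp_isometry_le (R : realType) (f h : R -> \bar R) (s : R -> R)
    (D : set R) : measurable D -> continuous s ->
  (forall u v, D u -> D v -> `|u - v| = `|s u - s v|) ->
  (forall t, D t -> f t = h (s t)) ->
  (forall t, 0 <= h t)%E -> measurable_fun setT h ->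
  (\int[lebesgue_measure]_(t in D) f t <= \int[lebesgue_measure]_t h t)%E.
Proof.
move=> mD cs sD fh h0 mh.
have -> : (\int[lebesgue_measure]_(t in D) f t =
           \int[lebesgue_measure]_(t in D) h (s t))%E.
  by apply: eq_integral => t /[!inE]; exact: fh.
rewrite -[leRHS]mul1e; apply: integral_comp_expanding => //.
  exact: continuous_measurable_fun.
by move=> u v Du Dv; rewrite mul1r sD.
Qed.

Section BoxIntegral.
Variables (R : realType) (a : R -> R) (M p B : R) (F : cplx R -> cplx R).
Hypotheses (M0 : 0 < M)
  (aM : forall u1 u2 : R, `|a u1 - a u2| <= M * `|u1 - u2|)
  (F_analytic : analytic_on (Omega_plus a) F).
Local Notation C := (cplx R).

Let F_pow (u v : R) : R := cmod (F (graph_point a u v)) `^ p.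

Lemma continuous_cmod_graph (T : topologicalType) (f g : T -> R) :
  continuous f -> continuous g -> (forall t, 0 < g t) ->
  continuous (fun t => cmod (F (graph_point a (f t) (g t)))).
Proof.
move=> cf cg g0 t.
apply: (@continuous_comp T C R (fun t => F (graph_point a (f t) (g t))) (@cmod R));
  last exact: continuous_cmod.
apply: (@continuous_comp T C C (fun t => graph_point a (f t) (g t)) F).
  exact: (continuous_graph_point M0 aM).
by apply: (analytic_on_continuous F_analytic); rewrite /Omega_plus/= ltrDl.
Qed.

Lemma measurable_F_pow (f g : R -> R) :
  continuous f -> continuous g -> (forall t, 0 < g t) ->
  measurable_fun setT (fun t => F_pow (f t) (g t)).
Proof.
move=> cf cg g0; apply: (measurableT_comp (measurable_powR p)).
by apply: continuous_measurable_fun; exact: continuous_cmod_graph.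
Qed.

Lemma measurable_F_pow2 (f g : R -> R) :
  continuous f -> continuous g -> (forall t, 0 < g t) ->
  measurable_fun [set: measurableTypeR R * measurableTypeR R]
    (fun z => F_pow (f z.1) (g z.2)).
Proof.
move=> cf cg g0; apply: (measurableT_comp (measurable_powR p)).
apply: (@measurable_fun_continuous2 _ (fun u v => cmod (F (graph_point a (f u) (g v))))).
apply: (@continuous_cmod_graph _ (fun z => f z.1) (fun z => g z.2)) => // z.
- apply: (@continuous_comp (R * R)%type R R fst f); [exact: cvg_fst|exact: cf].
- apply: (@continuous_comp (R * R)%type R R snd g); [exact: cvg_snd|exact: cg].
Qed.

Hypothesis B0 : 0 <= B.
Hypothesis FB : forall tau, 0 < tau ->
  (\int[lebesgue_measure]_u (F_pow u tau)%:E <= B%:E)%E.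

Variables (tau H N : R).
Hypotheses (tau0 : 0 < tau) (H0 : 0 < H) (HN : H <= N).

Lemma exists_vertical_sides_le : exists2 U, N <= U <= 2 * N &
  forall e, e = U \/ e = - U ->
    (\int[lebesgue_measure]_(v in `[tau, (tau + H)%R]) (F_pow e v)%:E
      <= (2 * B + 1)%:E)%E.
Proof.
have N0 : 0 < N by exact: lt_le_trans HN.
(* Truncating heights below at [tau] keeps the argument of [F] in [Omega_plus a], which gives
   measurability on the whole line. *)
have max0 v : 0 < Num.max v tau by rewrite lt_max tau0 orbT.
have cmax : continuous (fun v => Num.max v tau).
  by move=> v; apply: (@continuous_max _ _ id (fun=> tau)); [exact: cvg_id|exact: cst_continuous].
have cid : continuous (@id R) by move=> v; exact: cvg_id.
have coppr : continuous (-%R : R -> R) by exact: opp_continuous.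
have maxE v : tau <= v -> Num.max v tau = v by move=> ?; rewrite max_l.
(* One [U] must serve both vertical sides. A bound on a slice of the sum bounds each nonnegative
   summand, at the price of replacing [B] by [2 * B]. *)
pose f u v := F_pow u (Num.max v tau) + F_pow (- u) (Num.max v tau).
have f0 u v : 0 <= F_pow u v by exact: powR_ge0.
have mf0 u : measurable_fun [set: R] (fun v : R => (F_pow u (Num.max v tau))%:E).
  by apply/measurable_EFinP; apply: (@measurable_F_pow (fun=> u) (fun v => Num.max v tau)) => // ?; exact: cst_continuous.
have mf : measurable_fun [set: measurableTypeR R * measurableTypeR R]
    (fun z => f z.1 z.2).
  apply: measurable_funD.
    exact: (@measurable_F_pow2 id (fun v => Num.max v tau)).
  exact: (@measurable_F_pow2 -%R (fun v => Num.max v tau)).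
have f_ge0 u v : 0 <= f u v by exact: addr_ge0.
have HN' : tau + H - tau <= N by rewrite addrAC subrr add0r.
have fB v : tau <= v <= tau + H ->
    (\int[lebesgue_measure]_u (f u v)%:E <= (2 * B)%:E)%E.
  move=> /andP[tv _]; rewrite /f maxE//.
  have v0 : 0 < v by exact: lt_le_trans tv.
  have mv s : continuous s -> measurable_fun [set: R] (fun u : R => (F_pow (s u) v)%:E).
    by move=> cs; apply/measurable_EFinP; apply: (@measurable_F_pow s (fun=> v)) => // ?; exact: cst_continuous.
  under eq_integral do rewrite EFinD.
  rewrite ge0_integralD//=; last 4 first.
  - by move=> u _; rewrite lee_fin.
  - exact: mv.
  - by move=> u _; rewrite lee_fin.
  - exact: mv.
  rewrite mulr_natl mulr2n EFinD; apply: leeD; first exact: FB.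
  apply: le_trans (FB v0).
  apply: (integral_comp_isometry_le (s := -%R)) => //.
  - by move=> u w _ _; rewrite -opprD normrN.
  - by move=> u; rewrite lee_fin.
  - exact: mv.
have [U NU fU] := exists_slice_integral_le mf f_ge0 N0 HN' (mulr_ge0 (ler0n _ 2) B0) fB.
exists U => // e eU; apply: le_trans fU.
have -> : (\int[lebesgue_measure]_(v in `[tau, (tau + H)%R]) (F_pow e v)%:E =
    \int[lebesgue_measure]_(v in `[tau, (tau + H)%R]) (F_pow e (Num.max v tau))%:E)%E.
  by apply: eq_integral => v; rewrite inE/= in_itv/= => /andP[/maxE ->].
apply: ge0_le_integral => //.
- by move=> v _; rewrite lee_fin.
- by apply: measurable_funTS; exact: mf0.
- by apply: measurable_funTS; exact: (emeasurable_funD (mf0 U) (mf0 (- U))).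
- move=> v _; rewrite lee_fin /f.
  by case: eU => ->; rewrite ?lerDl ?lerDr.
Qed.

(** The horizontal sides contribute [B] each and the vertical ones [2 * B + 1] each; [4 + 2 * M] is
    the Lipschitz constant of [box_curve], the price of passing from arc length to its parameter. *)
Lemma exists_box_integral_le : exists2 U, N <= U <= 2 * N &
  (curve_integral (box_loop a U tau H) (fun z => cmod_pow p (F z))
    <= ((4 + 2 * M) * (6 * B + 2))%:E)%E.
Proof.
move: (H0) (tau0) (M0) => H_gt0 tau_gt0 M_gt0.
have N0 : 0 < N by exact: lt_le_trans HN.
have [U NU sideU] := exists_vertical_sides_le; exists U => //.
have U0 : 0 < U by apply: lt_le_trans N0 _; case/andP: NU.
have P0 := box_perimeter_gt0 U0 H0.
have K0 : 0 < 4 + 2 * M by lra.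
(* The second truncation never exceeds the first, so the height is at least [tau] on the whole line,
   beyond the parameter interval as well. *)
have height0 x : 0 < box_height U tau H x.
  have xle : x - (4 * U + H) <= x - 2 * U by lra.
  have /andP[+ _] := clamp_lipschitz (ltW H0) xle.
  by rewrite /box_height => ?; lra.
pose f x := cmod_pow p (F (box_curve a U tau H x)).
have f0 x : (0 <= f x)%E by rewrite lee_fin powR_ge0.
have mf : measurable_fun setT f.
  apply/measurable_EFinP; apply: (@measurable_F_pow (box_abs U H) (box_height U tau H)) => //.
    exact: continuous_box_abs.
  exact: continuous_box_height.
have cstc (u : R) : continuous (fun _ : R => u) by move=> ?; exact: cst_continuous.
have cid : continuous (@id R) by move=> v; exact: cvg_id.
have shift (c : R) : continuous (fun x => x + c).
  by move=> x; apply: continuousD; [exact: cvg_id|exact: cst_continuous].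
have reflect (c : R) : continuous (fun x => c - x).
  by move=> x; apply: continuousB; [exact: cst_continuous|exact: cvg_id].
have horizontal t s (D : interval R) : 0 < t -> continuous s ->
    (forall x y, `|x - y| = `|s x - s y|) ->
    (forall x, x \in D -> f x = (F_pow (s x) t)%:E) ->
    (\int[lebesgue_measure]_(x in [set` D]) f x <= B%:E)%E.
  move=> t0 cs s_iso fE; apply: le_trans (FB t0).
  apply: (@integral_comp_isometry_le _ f (fun u => (F_pow u t)%:E) s) => //.
  - by move=> u; rewrite lee_fin powR_ge0.
  - by apply/measurable_EFinP; exact: (@measurable_F_pow id (fun=> t)).
have vertical e s (D : interval R) : e = U \/ e = - U -> continuous s ->
    (forall x y, `|x - y| = `|s x - s y|) ->
    (forall x, x \in D -> tau <= s x <= tau + H /\ f x = (F_pow e (s x))%:E) ->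
    (\int[lebesgue_measure]_(x in [set` D]) f x <= (2 * B + 1)%:E)%E.
  move=> eU cs s_iso fE; apply: le_trans (sideU _ eU).
  have -> : (\int[lebesgue_measure]_(v in `[tau, (tau + H)%R]) (F_pow e v)%:E =
      \int[lebesgue_measure]_(v in `[tau, (tau + H)%R]) (F_pow e (Num.max v tau))%:E)%E.
    by apply: eq_integral => v; rewrite inE/= in_itv/= => /andP[? _]; rewrite max_l.
  rewrite [leRHS]integral_mkcond.
  apply: (@integral_comp_isometry_le _ f _ s) => //.
  - move=> x /= /fE[sx ->]; rewrite patchE mem_set//= ?in_itv//.
    by rewrite max_l//; case/andP: sx.
  - by move=> v; apply: erestrict_ge0 => ? _; rewrite lee_fin powR_ge0.
  - apply/(measurable_restrictT _ _).1 => //; apply: measurable_funTS.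
    apply/measurable_EFinP; apply: (@measurable_F_pow (fun=> e) (fun v => Num.max v tau)) => //.
      by move=> v; apply: (@continuous_max _ _ id (fun=> tau)); [exact: cvg_id|exact: cst_continuous].
    by move=> v; rewrite lt_max tau0 orbT.
apply: (le_trans (curve_integral_le K0 P0 (box_curve_lipschitz M0 aM tau U0 H0) _ _)).
- by move=> z; rewrite lee_fin powR_ge0.
- exact: measurable_funTS.
rewrite EFinM; apply: lee_wpmul2l; first by rewrite lee_fin ltW.
have split1 : 0 <= 2 * U by rewrite mulr_ge0// ltW.
have split2 : 2 * U <= 2 * U + H by rewrite lerDl ltW.
have split3 : 2 * U + H <= 4 * U + H by lra.
have split4 : 4 * U + H <= box_perimeter U H by rewrite /box_perimeter; lra.
have -> : (6 * B + 2)%:E = (B%:E + ((2 * B + 1)%:E + (B%:E + (2 * B + 1)%:E)))%E.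
  by rewrite -!EFinD; congr (_%:E); ring.
apply: (le_trans (integral_itv_split_le f0 mf split1 (le_trans split2 (le_trans split3 split4)))).
apply: leeD.
  apply: (horizontal tau (fun x => x + - U)) => //.
    by move=> x y; rewrite opprD addrACA subrr addr0.
  move=> x; rewrite in_itv/= => hx.
  by rewrite /f /box_curve; have [-> ->] := box_curve_bottom tau U0 H0 hx.
apply: (le_trans (integral_itv_split_le f0 mf split2 (le_trans split3 split4))).
apply: leeD.
  apply: (vertical U (fun x => x + (tau - 2 * U))) => //.
  - by left.
  - by move=> x y; rewrite opprD addrACA subrr addr0.
  move=> x; rewrite in_itv/= => hx; split.
    by move: hx => /andP[? ?]; apply/andP; split; lra.
  rewrite /f /box_curve; have [-> ->] := box_curve_right tau U0 H0 hx.
  by rewrite /cmod_pow /F_pow addrCA.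
apply: (le_trans (integral_itv_split_le f0 mf split3 split4)).
apply: leeD.
  apply: (horizontal (tau + H) (fun x => 3 * U + H - x)) => //.
  - by rewrite addr_gt0.
  - by move=> x y; rewrite distrC; congr (`|_|); ring.
  move=> x; rewrite in_itv/= => hx.
  by rewrite /f /box_curve; have [-> ->] := box_curve_top tau U0 H0 hx.
apply: (vertical (- U) (fun x => tau + box_perimeter U H - x)) => //.
- by right.
- by move=> x y; rewrite distrC; congr (`|_|); ring.
move=> x; rewrite in_itv/= => hx; split.
  by move: hx; rewrite /box_perimeter => /andP[? ?]; apply/andP; split; lra.
rewrite /f /box_curve; have [-> ->] := box_curve_left tau U0 H0 hx.
by rewrite /cmod_pow /F_pow addrA.
Qed.

End BoxIntegral.

(** * Exhaustion of the domain *)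

Lemma compact_Omega_plus_bounds (R : realType) (a : R -> R) (K : set (cplx R)) :
  continuous (graph_height a) -> compact K -> K `<=` Omega_plus a ->
  exists2 b : R, 0 < b & forall z, K z ->
    `|complex.Re z| <= b /\ b^-1 <= graph_height a z <= b.
Proof.
move=> ch cK KO; have [->|K0] := eqVneq K set0; first by exists 1.
have Kne : K !=set0 by exact/set0P.
have cRe : continuous (fun z : cplx R => `|complex.Re z|).
  move=> z; apply: (@continuous_comp (cplx R) R R (@complex.Re R) Num.norm).
    exact: continuous_Re.
  exact: norm_continuous.
have [z1 _ max1] := compact_EVT_max Kne cK (continuous_subspaceT cRe).
have [z2 _ max2] := compact_EVT_max Kne cK (continuous_subspaceT ch).
have [z3 /set_mem Kz3 min3] := compact_EVT_min Kne cK (continuous_subspaceT ch).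
have h3 : 0 < graph_height a z3 by rewrite subr_gt0; exact: KO.
set x := `|complex.Re z1| in max1; set y := graph_height a z2 in max2.
set w := graph_height a z3 in h3 min3.
have w0 : 0 < w^-1 by rewrite invr_gt0.
have b0 : 0 < x + `|y| + w^-1 by rewrite ltr_wpDl// addr_ge0// normr_ge0.
(* The summands are nonnegative, so the sum dominates each bound, and its inverse is at most the
   least height [w]. *)
exists (x + `|y| + w^-1) => // z /mem_set Kz.
have x0 : 0 <= x by exact: normr_ge0.
have yy := ler_norm y; have y0 := normr_ge0 y.
split; first by apply: (le_trans (max1 _ Kz)); lra.
apply/andP; split; last by apply: (le_trans (max2 _ Kz)); lra.
apply: le_trans (min3 _ Kz); rewrite -[leRHS]invrK lef_pV2 ?posrE//; lra.
Qed.

Theorem mainTheorem4 (R : realType) (a : R -> R) (M : R) (hM : 0 < M)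
    (ha : forall u1 u2 : R, `|a u1 - a u2| <= M * `|u1 - u2|)
    (p : R) (hp : 0 < p) :
  Hp a p `<=` Ep p (Omega_plus a).
Proof.
move=> F HF; have [F_an _] := HF; split=> //.
have [B B0 FB] := Hp_integral_bound hp HF.
(* The shift by 2 gives [T n > 1] for every [n], so every rectangle has positive height. *)
pose T (n : nat) : R := n.+2%:R.
have T1 n : 1 < T n by rewrite ltr1n.
have T0 n : 0 < T n by exact: lt_trans (T1 n).
have tau0 n : 0 < (T n)^-1 by rewrite invr_gt0.
have tau1 n : (T n)^-1 < 1 by rewrite invf_lt1.
have H0 n : 0 < T n - (T n)^-1.
  by rewrite subr_gt0; exact: lt_trans (tau1 n) (T1 n).
have HT n : T n - (T n)^-1 <= T n by rewrite gerBl ltW.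
pose box n := cid2 (exists_box_integral_le hM ha F_an B0 FB (tau0 n) (H0 n) (HT n)).
pose U n := s2val (box n).
have TU n : T n <= U n by have /andP[] := s2valP (box n).
have U0 n : 0 < U n by exact: lt_le_trans (T0 n) (TU n).
exists (fun n => box_loop a (U n) (T n)^-1 (T n - (T n)^-1)); split.
- move=> n; split; first exact: (rectifiable_jordan_box_loop hM ha).
  exact: trace_box_loop_Omega_plus.
- move=> K [_ [_ _ cK KO]].
  have [b b0 Kb] := compact_Omega_plus_bounds (continuous_graph_height hM ha) cK KO.
  (* Once [b < T n], the points of [K] have abscissas below [U n] in absolute value and heights
     strictly between [(T n)^-1] and [T n]. *)
  near=> n => z Kz; apply: (box_gauge_inside hM ha) => //.
  have [h1 /andP[h2 h3]] := Kb z Kz.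
  have bT : b < T n.
    by apply: (@lt_trans _ _ n%:R); [near: n; exact: nbhs_infty_gtr|rewrite ltr_nat].
  have Tb : (T n)^-1 < b^-1 by rewrite ltf_pV2 ?posrE.
  rewrite /box_gauge !gt_max; apply/and3P; split.
  + by rewrite subr_lt0 (le_lt_trans h1)// (lt_le_trans bT).
  + by rewrite subr_lt0 (lt_le_trans Tb).
  + by rewrite subr_lt0 addrC subrK (le_lt_trans h3).
- apply: (@le_lt_trans _ _ ((4 + 2 * M) * (6 * B + 2))%:E); last exact: ltry.
  by apply: ge_ereal_sup => _ [n _ <-]; exact: s2valP' (box n).
Unshelve. all: by end_near. Qed.
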